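(* Suppose that for each $n \in \mathbb{N}$, $T_n = t_n(U^n)$ is a sufficient statistic for the model $\{P_\delta : \delta \in \Delta\}$ and data $U^n$, and that $T_n$ satisfies the Monotone Likelihood Ratio (MLR) Property. Then for any $\delta_0, \delta^+ \in \Delta$ with $\delta_0 < \delta^+$, all $n \ge 1$, and all $u^n = (u_1,\ldots,u_n) \in \mathcal{U}^{(n)}$, with $u^{n-1} = (u_1,\ldots,u_{n-1})$ and with all densities $p_{\delta^+}$ taken relative to $P_{\delta_0}$, we have $$p_{\delta^+}^{U_n}(u_n \mid u^{n-1}) = p_{\delta^+}^{T_n}(t_n(u^n) \mid u^{n-1}),$$ and the conditional likelihood ratio $p_{\delta^+}^{T_n}(t \mid u^{n-1})$ is increasing in $t$ (over the possible values $t \in \{t_n(u^{n-1},u) : u \in \mathcal{U}_n\}$).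
   Context: Setting. $U_1, U_2, \ldots$ is a stochastic process, where $U_i$ has support $\mathcal{U}_i \subset \mathbb{R}$. Write $U^n = (U_1,\ldots,U_n)$ and $\mathcal{U}^{(n)} = \mathcal{U}_1 \times \cdots \times \mathcal{U}_n$; for $n=1$ the past $u^{0}$ is empty and conditioning on it is no conditioning. $\{P_\delta : \delta \in \Delta\}$ is a one-parameter statistical model for this process, with $\Delta \subseteq \mathbb{R}$ an interval. Standing assumption: for all $\delta \in \Delta$ there is a version of the conditional distribution $P_\delta(U_i = \cdot \mid U^{i-1})$ such that, for all $i$, all $u^{i-1} \in \mathcal{U}^{(i-1)}$ and all $\delta \in \Delta$, the distributions $P_\delta(U_i = \cdot \mid U^{i-1} = u^{i-1})$ are mutually absolutely continuous (across $\delta$), share the same support $\mathcal{U}_i$, and have densities $f_\delta^{U_i}(\cdot \mid u^{i-1})$ relative to Lebesgue or counting measure that coincide with their elementary conditional densities (joint density divided by marginal density). These densities are taken to be positive on $\mathcal{U}_i$, so that likelihood ratios are defined everywhere on the support. Likelihood ratio notation. Fix $\delta_0 \in \Delta$. The symbol $p_\delta$ always denotes a density of $P_\delta$ relative to $P_{\delta_0}$: for a random quantity $V$, $p_\delta^V(v) = f_\delta^V(v)/f_{\delta_0}^V(v)$, the density of the law of $V$ under $P_\delta$ relative to its law under $P_{\delta_0}$; $p_\delta^{U_n}(u \mid u^{n-1}) = f_\delta^{U_n}(u \mid u^{n-1})/f_{\delta_0}^{U_n}(u \mid u^{n-1})$; and $p_\delta^{U^n}(u^n) = \prod_{i=1}^n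 p_\delta^{U_i}(u_i \mid u^{i-1})$. For a statistic $T_n = t_n(U^n)$, $p_\delta^{T_n}(\cdot \mid u^{n-1})$ is the density of the conditional law of $T_n$ given $U^{n-1}=u^{n-1}$ under $P_\delta$ relative to the conditional law of $T_n$ given $U^{n-1}=u^{n-1}$ under $P_{\delta_0}$, i.e. $p_\delta^{T_n}(t \mid u^{n-1}) = \mathbf{E}_{\delta_0}[p_\delta^{U_n}(U_n \mid u^{n-1}) \mid U^{n-1}=u^{n-1},\, t_n(u^{n-1},U_n) = t]$ for possible values $t$; since such a conditional expectation is determined only up to null sets, pointwise statements about it refer to a suitable version. Sufficiency. $T_n$ is a sufficient statistic for $\{P_\delta : \delta \in \Delta\}$ and data $U^n$ if, with $f_\delta^{T_n}$ and $f_\delta^{U^n}$ denoting densities of $T_n$ and $U^n$ under $P_\delta$ relative to some ($\delta$-independent) background measures, there are functions $t_n : \mathcal{U}^{(n)} \to \mathbb{R}$ and $q_n : \mathcal{U}^{(n)} \to \mathbb{R}^+$ such that $T_n = t_n(U^n)$ and, for all $\delta \in \Delta$ and all $u^n \in \mathcal{U}^{(n)}$, $$f_\delta^{U^n}(u^n) = f_\delta^{T_n}(t_n(u^n)) \cdot q_n(u^n).$$ MLR Property. A real random variable $T$ with common support (set of possible values) $\mathcal{T}$ under all $P_\delta$, $\delta \in \Delta$, satisfies the MLR Property if for all $\delta_0, \delta^+ \in \Delta$ with $\delta_0 \le \delta^+$, the likelihood ratio $p_{\delta^+}^T(t) = f_{\delta^+}^T(t)/f_{\delta_0}^T(t)$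 is increasing as a function of $t \in \mathcal{T}$. Throughout, ''increasing'' is meant in the non-strict sense. *)

(* Defs.v *)
From HB Require Import structures.
From mathcomp Require Import all_boot all_order all_algebra.
From mathcomp Require Import all_classical all_reals all_analysis.

Set Implicit Arguments.
Unset Strict Implicit.
Unset Printing Implicit Defensive.

Import Order.TTheory GRing.Theory Num.Theory.
Import numFieldNormedType.Exports.

Local Open Scope classical_set_scope.
Local Open Scope ring_scope.

(* The observation U_i of the mathematical text (i >= 1) has index i.-1 here,
   so that [U^n] is indexed by 'I_n and the next observation has index n. *)

Definition background (R : realType) (discrete : bool) : set R -> \bar R :=
  if discrete then counting else lebesgue_measure.

(* [D] carries the law and [f] matters on [D] only; in particular
   [law (~` D) = 0]. *)
Definition has_density (R : realType) (d : measure_display)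
    (T : measurableType d) (D : set T) (law mu : set T -> \bar R)
    (f : T -> R) : Prop :=
  [/\ measurable_fun D f,
      forall x, D x -> 0 <= f x &
      forall A, measurable A ->
        law A = (\int[mu]_(x in A `&` D) (f x)%:E)%E].

Section Observations.
Variable R : realType.

Definition support_prod (supp : nat -> set R) (n : nat) : set (n.-tuple R) :=
  [set u | forall i : 'I_n, supp i (tnth u i)].

(* Integral over [support_prod supp n] against the product of the measures
   [mu 0], ..., [mu n.-1], written as an iterated integral because the product
   measures of the library exclude the counting measure on R, which is not
   s-finite. *)
Fixpoint product_integral (mu : nat -> set R -> \bar R) (supp : nat -> set R)
    (n : nat) : (n.-tuple R -> \bar R) -> \bar R :=
  match n with
  | 0 => fun F => F [tuple]
  | m.+1 => fun F => product_integral mu supp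
              (fun u : m.-tuple R =>
                 (\int[mu m]_(x in supp m) F (rcons_tuple u x))%E)
  end.

Definition elementary_cond_density (f : forall n, n.-tuple R -> R)
    (n : nat) (u : n.-tuple R) (x : R) : R :=
  f n.+1 (rcons_tuple u x) / f n u.

Definition observations (T : Type) (U : nat -> T -> R) (n : nat) (w : T) :
    n.-tuple R :=
  [tuple U i w | i < n].

End Observations.
Arguments support_prod {R} supp n u.

(* [Pr delta] and the other data indexed by delta are only constrained for
   delta in [Delta]. *)
Record process_model (R : realType) (d : measure_display)
    (Omega : measurableType d) := ProcessModel {
  Delta : set R;
  Pr : R -> probability Omega R;
  proc : nat -> {mfun Omega >-> R};
  (* set of possible values of the observation of index n; it need not be
     topologically closed *)
  supp : nat -> set R;
  (* whether densities are relative to counting or to Lebesgue measure *)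
  discrete : nat -> bool;
  joint_density : R -> forall n, n.-tuple R -> R;
  (* [cond_law delta n u]: law of the observation of index n given U^n = u *)
  cond_law : R -> forall n, R.-pker (n.-tuple R) ~> R;
  Delta_interval : is_interval Delta;
  supp_measurable : forall n, measurable (supp n);
  joint_density_measurable : forall delta n, Delta delta ->
    measurable_fun (support_prod supp n) (@joint_density delta n);
  joint_densityE : forall delta n (A : set (n.-tuple R)), Delta delta ->
    measurable A ->
    Pr delta (observations proc n @^-1` A) =
    product_integral (fun i => background (discrete i)) supp
      (fun u : n.-tuple R => (joint_density delta u * \1_A u)%:E);
  cond_lawE : forall delta n (A : set (n.-tuple R)) (B : set R), Delta delta ->
    measurable A -> measurable B ->
    Pr delta (observations proc n @^-1` A `&` proc n @^-1` B) =
    (\int[Pr delta]_(w in observations proc n @^-1` A)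
       cond_law delta n (observations proc n w) B)%E;
  cond_law_dominates : forall delta delta' n (u : n.-tuple R),
    Delta delta -> Delta delta' -> support_prod supp n u ->
    cond_law delta n u `<< cond_law delta' n u;
  cond_law_density : forall delta n (u : n.-tuple R),
    Delta delta -> support_prod supp n u ->
    has_density (supp n) (cond_law delta n u) (background (discrete n))
      (elementary_cond_density (joint_density delta) u);
  cond_density_gt0 : forall delta n (u : n.-tuple R) (x : R),
    Delta delta -> support_prod supp n u -> supp n x ->
    0 < elementary_cond_density (joint_density delta) u x
}.

Section Statistics.
Variables (R : realType) (d : measure_display) (Omega : measurableType d).
Variable M : process_model R Omega.

Definition cond_density (delta : R) (n : nat) (u : n.-tuple R) (x : R) : R :=
  elementary_cond_density (joint_density M delta) u x.

Definition cond_lr (delta0 delta : R) (n : nat) (u : n.-tuple R) (x : R) : R :=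
  cond_density delta u x / cond_density delta0 u x.

Definition statistic (n : nat) (t : n.-tuple R -> R) (w : Omega) : R :=
  t (observations (proc M) n w).

Definition possible_values (n : nat) (t : n.-tuple R -> R) : set R :=
  t @` support_prod (supp M) n.

Definition cond_possible_values (n : nat) (t : n.+1.-tuple R -> R)
    (u : n.-tuple R) : set R :=
  (fun x => t (rcons_tuple u x)) @` supp M n.

(* [fT delta] is a density of the statistic relative to [nu]. The joint
   densities are relative to the product background; changing that background
   multiplies them by a factor free of delta, which [q] absorbs. *)
Definition sufficient (n : nat) (t : n.-tuple R -> R)
    (nu : set R -> \bar R) (fT : R -> R -> R) : Prop :=
  (forall delta, Delta M delta ->
     has_density setT (pushforward (Pr M delta) (statistic t)) nu (fT delta)) /\
  exists q : n.-tuple R -> R,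
    (forall u, support_prod (supp M) n u -> 0 < q u) /\
    forall delta u, Delta M delta -> support_prod (supp M) n u ->
      joint_density M delta u = fT delta (t u) * q u.

Definition MLR_property (T : set R) (fT : R -> R -> R) : Prop :=
  forall delta0 delta1, Delta M delta0 -> Delta M delta1 ->
    delta0 <= delta1 ->
    {in T &, {homo (fun s => fT delta1 s / fT delta0 s) : s s' / s <= s'}}.

Definition cond_law_statistic (n : nat) (t : n.+1.-tuple R -> R) (delta : R)
    (u : n.-tuple R) : set R -> \bar R :=
  pushforward (cond_law M delta n u) (fun x => t (rcons_tuple u x)).

(* [p] is a version of the conditional likelihood ratio of the statistic given
   the past [u]: these versions differ on null sets only. *)
Definition is_cond_lr_statistic (n : nat) (t : n.+1.-tuple R -> R)
    (delta0 delta : R) (u : n.-tuple R) (p : R -> R) : Prop :=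
  has_density setT (cond_law_statistic t delta u)
    (cond_law_statistic t delta0 u) p.

End Statistics.

(* Main.v *)
Require Import Defs.
From HB Require Import structures.
From mathcomp Require Import all_boot all_order all_algebra.
From mathcomp Require Import all_classical all_reals all_analysis.
From mathcomp Require Import measurable_realfun ring.

Set Implicit Arguments.
Unset Strict Implicit.
Unset Printing Implicit Defensive.

Import Order.TTheory GRing.Theory Num.Theory.
Import numFieldNormedType.Exports.

Local Open Scope classical_set_scope.
Local Open Scope ring_scope.

(* By sufficiency the factor [q] cancels from the joint likelihood ratio at
   [(u, x)], so the conditional ratio of the next observation is
   [c * fT delta1 s / fT delta0 s] at [s = t (u, x)], with a constant [c > 0]
   depending on the past [u] only. Hence it is a function of [s], increasing by
   the MLR property, and pushing the conditional laws forward along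
   [x |-> t (u, x)] shows that it is a conditional density of the statistic. *)

Section DensityIntegral.
Import HBNNSimple.

(** For an indicator this is the defining equation of the density; linearity gives it for
    nonnegative simple functions and monotone convergence for [h]. No sigma-finiteness of [mu] is
    assumed, so counting measure on the reals is covered. *)
Lemma has_density_integral (R : realType) (d : measure_display)
    (T : measurableType d) (law mu : {measure set T -> \bar R}) (D A : set T)
    (f : T -> R) (h : T -> \bar R) :
  measurable D -> has_density D law mu f -> measurable A ->
  measurable_fun A h -> (forall x, A x -> 0 <= h x)%E ->
  (\int[law]_(x in A) h x = \int[mu]_(x in A `&` D) (h x * (f x)%:E))%E.
Proof.
move=> mD [mf f0 lawE] mA mh h0.
have mAD : measurable (A `&` D) by exact: measurableI.
have mfAD : measurable_fun (A `&` D) (EFin \o f).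
  by apply/measurable_EFinP; apply: (measurable_funS mD) => // x [].
have f0AD x : (A `&` D) x -> (0 <= (f x)%:E)%E by move=> [_ /f0]; rewrite lee_fin.
pose s := nnsfun_approx mA mh.
have sE x : A x -> h x = limn (fun n => (s n x)%:E).
  by move=> Ax; apply/esym/cvg_lim => //; exact: cvg_nnsfun_approx.
have s_nd x : {homo (fun n => s n x) : m n / (m <= n)%N >-> m <= n}.
  by move=> m n mn; exact/lefP/nd_nnsfun_approx.
have ms E n : measurable_fun E (fun x => (s n x)%:E).
  exact/measurable_EFinP/measurable_funTS.
have -> : (\int[law]_(x in A) h x =
    limn (fun n => \int[law]_(x in A) (s n x)%:E))%E.
  under eq_integral => x /[!inE] /sE -> //.
  apply: monotone_convergence => // [n x _|x _ m n mn]; first by rewrite lee_fin.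
  by rewrite lee_fin; exact: s_nd.
have -> : (\int[mu]_(x in A `&` D) (h x * (f x)%:E) =
    limn (fun n => \int[mu]_(x in A `&` D) ((s n x)%:E * (f x)%:E)))%E.
  have hfE x : (A `&` D) x ->
      (h x * (f x)%:E)%E = limn (fun n => (s n x)%:E * (f x)%:E)%E.
    move=> [Ax _]; apply/esym/cvg_lim => //; apply: cvgeZr => //.
    exact: cvg_nnsfun_approx.
  under eq_integral => x /[!inE] /hfE -> //.
  apply: monotone_convergence => // [n|n x xAD|x xAD m n mn].
  - exact: emeasurable_funM.
  - by rewrite mule_ge0 ?f0AD// lee_fin.
  - by rewrite lee_wpmul2r ?f0AD// lee_fin; exact: s_nd.
congr (limn _); apply/funext => n.
have s_ge0 r x : (0 <= (r * \1_(s n @^-1` [set r]) x)%:E)%E.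
  exact: nnfun_muleindic_ge0.
have ms_indic E r : measurable_fun E (fun x => (r * \1_(s n @^-1` [set r]) x)%:E).
  apply/measurable_EFinP; apply: measurable_funTS; exact: measurable_funM.
transitivity (\int[law]_(x in A)
    (\sum_(r \in range (s n)) (r * \1_(s n @^-1` [set r]) x)%:E))%E.
  by apply: eq_integral => x _; rewrite fsumEFin// -fimfunE.
rewrite ge0_integral_fsum//.
transitivity (\int[mu]_(x in A `&` D)
    (\sum_(r \in range (s n)) ((r * \1_(s n @^-1` [set r]) x)%:E * (f x)%:E)))%E;
    last first.
  apply: eq_integral => x _.
  by rewrite -ge0_mule_fsuml// fsumEFin// -fimfunE.
rewrite ge0_integral_fsum//; last 2 first.
- by move=> r; exact: emeasurable_funM.
- by move=> r x xAD; rewrite mule_ge0 ?f0AD.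
apply: eq_fsbigr => r; rewrite inE => -[y _ yr].
have r0 : 0 <= r by rewrite -yr.
have mr : measurable (s n @^-1` [set r]) by exact: measurable_sfunP.
under eq_integral do rewrite EFinM.
under [RHS]eq_integral do rewrite EFinM -muleA.
rewrite ge0_integralZl//; last exact/measurable_EFinP/measurable_funTS.
rewrite ge0_integralZl//; last 2 first.
- apply: emeasurable_funM => //; exact/measurable_EFinP/measurable_funTS.
- by move=> x xAD; rewrite mule_ge0 ?f0AD// lee_fin.
(* On a single level set both sides are the integral of [f] over its trace on [A] and [D]. *)
congr (_ * _)%E; rewrite integral_indic// lawE; last exact: measurableI.
under [RHS]eq_integral do rewrite muleC.
rewrite [RHS](eq_integral ((EFin \o f) \_ (s n @^-1` [set r]))); last first.
  by move=> x _; rewrite epatch_indic.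
by rewrite -integral_mkcondr setIAC [A `&` _]setIC.
Qed.

End DensityIntegral.

(** [background b] is a bare set function, while the integration lemmas ask for a measure
    structure. *)
Lemma background_measure (R : realType) (b : bool) :
  exists mu : {measure set R -> \bar R}, background b = mu.
Proof.
case: b; first by exists (@counting R R).
(* In the library [lebesgue_measure] is a measure on [measurableTypeR R], which
   has the same measurable sets as [R] but another display. *)
pose mx := isMeasure.Build _ R R (@lebesgue_measure R : set R -> \bar R)
  (@measure0 _ _ _ (@lebesgue_measure R)) (@measure_ge0 _ _ _ (@lebesgue_measure R))
  (@measure_semi_sigma_additive _ _ _ (@lebesgue_measure R)).
pose mu : {measure set R -> \bar R} :=
  HB.pack (@lebesgue_measure R : set R -> \bar R) mx.
by exists mu.
Qed.

(** Change of variables along [g] turns the integral of [p] into one of [p \o g] against [law0]; the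
    density [f0] then makes the integrand [p (g x) * f0 x], which is [f1 x]. *)
Lemma has_density_pushforward (R : realType) (d d' : measure_display)
    (T : measurableType d) (T' : measurableType d')
    (law0 law1 mu : {measure set T -> \bar R}) (D : set T) (f0 f1 : T -> R)
    (g : T -> T') (p : T' -> R) :
  measurable D -> measurable_fun setT g -> measurable_fun setT p ->
  (forall y, 0 <= p y) -> has_density D law0 mu f0 -> has_density D law1 mu f1 ->
  (forall x, D x -> f1 x = p (g x) * f0 x) ->
  has_density setT (pushforward law1 g) (pushforward law0 g) p.
Proof.
move=> mD mg mp p0 law0D [_ _ law1E] f1E; split => // A mA.
have mgA : measurable (g @^-1` A) by rewrite -[X in measurable X]setTI; exact: mg.
rewrite setIT ge0_integral_pushforward//; last 2 first.
- exact/measurable_EFinP/measurable_funTS.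
- by move=> y _; rewrite lee_fin.
rewrite (has_density_integral mD law0D)//; last 2 first.
- by apply/measurable_EFinP/measurable_funTS; exact: measurableT_comp.
- by move=> x _; rewrite lee_fin.
rewrite /pushforward law1E//; apply: eq_integral => x; rewrite inE => -[_ Dx].
by rewrite f1E// EFinM.
Qed.

Lemma measurable_rcons_tuple (d : measure_display) (T : measurableType d)
    (n : nat) (u : n.-tuple T) : measurable_fun setT (rcons_tuple u).
Proof.
apply/measurable_fun_tnthP => i.
have [iltn|nlei] := ltnP i n.
  rewrite (_ : _ \o _ = cst (tnth u (Ordinal iltn)))//.
  apply/funext => x /=; rewrite !(tnth_nth x) /= nth_rcons size_tuple iltn//.
rewrite (_ : _ \o _ = idfun); [exact: measurable_id|apply/funext => x /=].
have -> : i = ord_max by apply/val_inj/eqP; rewrite eqn_leq nlei -ltnS ltn_ord.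
by rewrite (tnth_nth x) /= nth_rcons size_tuple ltnn eqxx.
Qed.

Lemma support_prod_rcons (R : realType) (supp : nat -> set R) (n : nat)
    (u : n.-tuple R) (x : R) :
  support_prod supp n u -> supp n x -> support_prod supp n.+1 (rcons_tuple u x).
Proof.
move=> su sx i; rewrite (tnth_nth x) /= nth_rcons size_tuple.
case: ltnP => [iltn|nlei]; first by have := su (Ordinal iltn); rewrite (tnth_nth x).
have -> : i = n :> nat by apply/eqP; rewrite eqn_leq nlei -ltnS ltn_ord.
by rewrite eqxx.
Qed.

Theorem lemma3 (R : realType) (d : measure_display) (Omega : measurableType d)
    (M : process_model R Omega)
    (t : forall n : nat, {mfun n.-tuple R >-> R})
    (nu : nat -> {measure set R -> \bar R}) (fT : nat -> R -> R -> R)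
    (Hsuff : forall n : nat, (0 < n)%N -> sufficient M (t n) (nu n) (fT n))
    (Hmlr : forall n : nat, (0 < n)%N ->
       MLR_property M (possible_values M (t n)) (fT n)) :
  forall delta0 delta1 : R, Delta M delta0 -> Delta M delta1 ->
    delta0 < delta1 ->
  forall (n : nat) (u : n.-tuple R), support_prod (supp M) n u ->
  exists p : R -> R,
    [/\ is_cond_lr_statistic M (t n.+1) delta0 delta1 u p,
        forall x : R, supp M n x ->
          cond_lr M delta0 delta1 u x = p (t n.+1 (rcons_tuple u x)) &
        {in cond_possible_values M (t n.+1) u &,
          {homo p : s s' / s <= s'}}].
Proof.
move=> delta0 delta1 D0 D1 lt01 n u su.
(* The observation of index [n] completes a tuple of length [n.+1], so sufficiency is used at
   [n.+1], also when the past is empty. *)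
have [fTD [q [q0 fE]]] := Hsuff n.+1 isT.
have fT_ge0 delta s : Delta M delta -> 0 <= fT n.+1 delta s.
  by move=> /fTD [_ + _]; exact.
have mfT delta : Delta M delta -> measurable_fun setT (fT n.+1 delta).
  by move=> /fTD [].
(* Positivity of the conditional density only fixes the sign of the quotient
   [f n.+1 / f n]; sufficiency makes the numerator nonnegative. *)
have f_gt0 delta x : Delta M delta -> supp M n x ->
    0 < joint_density M delta u /\
    0 < fT n.+1 delta (t n.+1 (rcons_tuple u x)).
  move=> Dd sx; have := cond_density_gt0 Dd su sx.
  have sux := support_prod_rcons su sx.
  have qx := q0 _ sux.
  rewrite /elementary_cond_density fE//.
  have := fT_ge0 delta (t n.+1 (rcons_tuple u x)) Dd.
  rewrite le_eqVlt => /orP[/eqP <-|fTx]; first by rewrite !mul0r ltxx.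
  by rewrite pmulr_rgt0 ?mulr_gt0// invr_gt0.
pose c := joint_density M delta0 u / joint_density M delta1 u.
(* The sign of [c] is read off at a point of the support. An empty support would give the
   conditional law total mass 0, yet it is a probability. *)
have [[x0 sx0]|supp0] := pselect (exists x, supp M n x); last first.
  have : cond_law M delta0 n u setT = 0%E.
    have [_ _ ->//] := cond_law_density D0 su.
    have [mu ->] := background_measure R (discrete M n).
    rewrite setTI (_ : supp M n = set0) ?integral_set0//.
    by apply/seteqP; split => // x sx; apply: supp0; exists x.
  by rewrite prob_kernel => /eqP; rewrite onee_eq0.
have c_gt0 : 0 < c.
  by rewrite divr_gt0 ?(f_gt0 _ x0 D0 sx0).1 ?(f_gt0 _ x0 D1 sx0).1.
(* Where [fT n.+1 delta0] vanishes the quotient is 0 by convention, so [p] is defined and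
   nonnegative on the whole line. *)
pose p s := c * (fT n.+1 delta1 s / fT n.+1 delta0 s).
have lrE x : supp M n x ->
    cond_lr M delta0 delta1 u x = p (t n.+1 (rcons_tuple u x)).
  move=> sx; have sux := support_prod_rcons su sx.
  have [f00 fT0] := f_gt0 _ x D0 sx; have [f10 fT1] := f_gt0 _ x D1 sx.
  have qx := q0 _ sux.
  rewrite /cond_lr /cond_density /elementary_cond_density !fE// /p /c.
  by field; rewrite !gt_eqF.
exists p; split => //; last first.
  move=> s s'; rewrite !inE => -[x sx <-] [x' sx' <-] ss'.
  rewrite ler_pM2l//; apply: (Hmlr n.+1 isT _ _ D0 D1 (ltW lt01)) => //.
    by rewrite inE; exists (rcons_tuple u x) => //; exact: support_prod_rcons.
  by rewrite inE; exists (rcons_tuple u x') => //; exact: support_prod_rcons.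
have [mu muE] := background_measure R (discrete M n).
have := cond_law_density D1 su; have := cond_law_density D0 su.
rewrite muE => law0D law1D.
apply: (has_density_pushforward _ _ _ _ law0D law1D).
- exact: supp_measurable.
- by apply: measurableT_comp => //; exact: measurable_rcons_tuple.
- apply: measurable_funM => //; apply: measurable_funM; first exact: mfT.
  (* On nonnegative reals, 0 included, the inverse agrees with the power of exponent -1, whose
     measurability is known. *)
  rewrite (_ : (fun s => _) = (fun s => fT n.+1 delta0 s `^ (-1))); last first.
    by apply/funext => s; rewrite powR_inv1//; exact: fT_ge0.
  by apply: (measurableT_comp (measurable_powR _)); exact: mfT.
- by move=> s; apply: mulr_ge0; [exact: ltW|apply: divr_ge0; exact: fT_ge0].
- move=> x sx; rewrite -lrE// /cond_lr /cond_density divfK// gt_eqF//.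
  exact: cond_density_gt0.
Qed.
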